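(* Let $S$ be a semigroup of rational maps whose Koopman (anti-)representation is left amenable. Then $S$ admits a common invariant probability measure on $\overline{\mathbb{C}}$, that is, there is a Borel probability measure $\mu$ on $\overline{\mathbb{C}}$ with $g_*\mu=\mu$ for every $g\in S$.
   Context: A semigroup of rational maps is a non-empty family of rational maps of $\overline{\mathbb{C}}$ closed under composition, with composition as product. For a semigroup $S$, $L_\infty(S)$ is the space of bounded complex functions on $S$ with supremum norm, and $(l_s\phi)(t)=\phi(st)$. A mean is a positive continuous linear functional $M$ on $L_\infty(S)$ with $M(1)=1$. A left-invariant subspace $X\subset L_\infty(S)$ (i.e. $l_s X\subset X$ for all $s$) containing the constants is left amenable if there is a mean $M$ whose restriction to $X$ satisfies $M(l_s\phi)=M(\phi)$ for all $s\in S$, $\phi\in X$. Let $\rho:S\to End(B)$ be a bounded homomorphism or anti-homomorphism into the semigroup of continuous linear endomorphisms of a Banach space $B$ with dual $B^*$. For $(b,b^* )\in B\times B^*$ put $f_{(b,b^* )}(s)=b^*(\rho(s)(b))$. Let $Y_\rho\subset L_\infty(S)$ be the closure of the linear span of all $f_{(b,b^* )}$ and $X_\rho$ the space generated by $Y_\rho$ and the constant functions; $X_\rho$ is left and right invariant. $\rho$ is called left amenable if $X_\rho$ is a left amenable subspace of $L_\infty(S)$. The Koopman (anti-)representation of $S$ is the bounded anti-homomorphism $R\mapsto K_R$ into the endomorphisms of the Banach space $\mathcal{C}(\overline{\mathbb{C}})$ of continuous functions with supremum norm, $K_R(\phi)=\phi\circ R$. *)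

(* Defs.v *)
(* Mathematical Components and MathComp-Analysis. *)
From HB Require Import structures.
From mathcomp Require Import all_boot all_order all_algebra complex.
From mathcomp Require Import all_classical all_reals all_analysis.
From mathcomp Require Import lra.
Set Implicit Arguments.
Unset Strict Implicit.
Unset Printing Implicit Defensive.
Import Order.TTheory GRing.Theory Num.Theory numFieldNormedType.Exports.
Local Open Scope classical_set_scope.
Local Open Scope ring_scope.
Local Open Scope complex_scope.

HB.instance Definition _ (R : realType) := NormedModule.copy R[i] (R[i]^o).

Section complex_topology.
Variable R : realType.
Implicit Types (x y z : R[i]).
Local Notation normc := (@Normc.normc R).
Local Notation Re := (@complex.Re R).
Local Notation Im := (@complex.Im R).

Lemma normcE z : `|z| = (normc z)%:C. Proof. by []. Qed.

Lemma normc_ge0 z : 0 <= normc z.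
Proof. by rewrite -ler0c -normcE. Qed.

Lemma ler_Re_normc z : `|Re z| <= normc z.
Proof.
case: z => a b /=; rewrite -sqrtr_sqr ler_sqrt ?addr_ge0 ?sqr_ge0//.
by rewrite lerDl sqr_ge0.
Qed.

Lemma ler_Im_normc z : `|Im z| <= normc z.
Proof.
case: z => a b /=; rewrite -sqrtr_sqr ler_sqrt ?addr_ge0 ?sqr_ge0//.
by rewrite lerDr sqr_ge0.
Qed.

Lemma ler_normc_ReIm z : normc z <= `|Re z| + `|Im z|.
Proof.
rewrite -lecR -normcE {1}[z]complex.complexE (le_trans (ler_normD _ _))//.
rewrite normrM rmorphD/= lerD//.
  by rewrite normcE /= expr0n addr0 sqrtr_sqr.
by rewrite !normcE /= !expr0n/= addr0 add0r expr1n sqrtr1 mul1r sqrtr_sqr.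
Qed.

Lemma gt0_complex z : 0 < z -> z = (Re z)%:C /\ 0 < Re z.
Proof. by case: z => a b; rewrite ltcE /= => /andP[/eqP -> ?]. Qed.

Lemma cvgcP T (F : set_system T) {FF : Filter F} (f : T -> R[i]) z :
  f @ F --> z <-> forall e : R, 0 < e -> \forall t \near F, normc (z - f t) <= e.
Proof.
split=> [/cvgrPdist_le fz e e0|fz].
  have /fz : 0 < e%:C by rewrite ltcR.
  by apply: filterS => t; rewrite normcE lecR.
apply/cvgrPdist_le => e /gt0_complex[-> e0].
by apply: filterS (fz _ e0) => t; rewrite normcE lecR.
Qed.

Lemma near_normc z (e : R) : 0 < e -> \forall t \near z, normc (z - t) <= e.
Proof.
move=> e0; apply/nbhs_ballP; exists e%:C; first by rewrite /= ltcR.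
by move=> t /ltW; rewrite normcE lecR.
Qed.

Lemma normrC (a : R) : `|a%:C| = `|a|%:C.
Proof. by rewrite normcE /= expr0n addr0 sqrtr_sqr. Qed.

Lemma continuous_normc : continuous normc.
Proof.
move=> z; apply/(@cvgrPdist_le _ _ _ (nbhs z)) => e e0.
apply: (@filterS _ (nbhs z) _ _ _ _ (near_normc z e0)) => t; apply: le_trans.
by rewrite -lecR -normrC rmorphB/= -!normcE ler_dist_dist.
Qed.

Lemma continuous_Re : continuous Re.
Proof.
move=> z; apply/(@cvgrPdist_le _ _ _ (nbhs z)) => e e0.
apply: (@filterS _ (nbhs z) _ _ _ _ (near_normc z e0)) => t; apply: le_trans.
by rewrite -raddfB ler_Re_normc.
Qed.

Lemma continuous_Im : continuous Im.
Proof.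
move=> z; apply/(@cvgrPdist_le _ _ _ (nbhs z)) => e e0.
apply: (@filterS _ (nbhs z) _ _ _ _ (near_normc z e0)) => t; apply: le_trans.
by rewrite -raddfB ler_Im_normc.
Qed.

Lemma cvg_complex T (F : set_system T) {FF : Filter F} (f g : T -> R) (a b : R) :
  f @ F --> a -> g @ F --> b -> (f t +i* g t) @[t --> F] --> (a +i* b).
Proof.
move=> /cvgrPdist_le fa /cvgrPdist_le gb; apply/cvgcP => e e0.
have e2 : 0 < e / 2 by rewrite divr_gt0.
near=> t; apply: (le_trans (ler_normc_ReIm _)) => /=.
by rewrite (splitr e); apply: lerD; near: t; [exact: fa|exact: gb].
Unshelve. all: by end_near. Qed.

Lemma complex_complete (F : set_system R[i]) : ProperFilter F -> cauchy F -> cvg F.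
Proof.
move=> FF /cauchyP Fc.
have Rec : cvg (Re @ F).
  apply/cauchy_cvgP; apply: cauchy_exP => e e0.
  have /Fc[z Fz] : 0 < e%:C by rewrite ltcR.
  exists (Re z); apply: (@filterS _ F _ _ _ _ Fz) => t zt; change (`|Re z - Re t| < e).
  apply: (@le_lt_trans _ _ (normc (z - t))); last by rewrite -ltcR.
  by rewrite -raddfB ler_Re_normc.
have Imc : cvg (Im @ F).
  apply/cauchy_cvgP; apply: cauchy_exP => e e0.
  have /Fc[z Fz] : 0 < e%:C by rewrite ltcR.
  exists (Im z); apply: (@filterS _ F _ _ _ _ Fz) => t zt; change (`|Im z - Im t| < e).
  apply: (@le_lt_trans _ _ (normc (z - t))); last by rewrite -ltcR.
  by rewrite -raddfB ler_Im_normc.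
apply/cvg_ex; exists (lim (Re @ F) +i* lim (Im @ F)).
have H := cvg_complex Rec Imc.
rewrite (_ : (fun t => Re t +i* Im t) = id) in H; last by apply/funext; case.
exact: H.
Qed.

Lemma compact_complexP (A : set R[i]) :
  compact A -> exists M : R, forall z, A z -> normc z <= M.
Proof.
move=> cA.
have /compact_bounded[M [Mr MA]] : compact (normc @` A).
  by apply: continuous_compact => //; apply: continuous_subspaceT => ?; exact: continuous_normc.
exists (M + 1) => z Az; have := MA (M + 1).
rewrite ltrDl ltr01 => /(_ isT (normc z)) /=.
by rewrite ger0_norm ?normc_ge0//; apply; exists z.
Qed.

Lemma closed_normc_le (M : R) : closed [set z | normc z <= M].
Proof.
have -> : [set z | normc z <= M] = normc @^-1` [set x | x <= M] by [].
apply: closed_comp => [z _|]; [exact: continuous_normc|exact: closed_le].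
Qed.

Lemma compact_normc_le (M : R) : compact [set z | normc z <= M].
Proof.
pose f (p : R * R) := p.1 +i* p.2.
apply: (@subclosed_compact _ _ (f @` (`[- M, M] `*` `[- M, M]))).
- exact: closed_normc_le.
- apply: continuous_compact; last by apply: compact_setX; exact: segment_compact.
  apply: continuous_subspaceT => p.
  by apply: cvg_complex; [exact: cvg_fst|exact: cvg_snd].
- move=> z /= zM; exists (Re z, Im z); last by case: z {zM}.
  by split; rewrite /= in_itv /= -ler_norml (le_trans _ zM)// ?ler_Re_normc ?ler_Im_normc.
Qed.

End complex_topology.

HB.instance Definition _ (R : realType) :=
  Uniform_isComplete.Build R[i] (@complex_complete R).

Record bfspace (R : realType) (T : Type) := BFSpace {
  bf_set :> set (T -> R[i]);
  bf_bounded : bf_set `<=` bounded_fun;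
  bf_zero : bf_set 0;
  bf_lin : forall a f g, bf_set f -> bf_set g -> bf_set (a *: f + g);
  bf_closed : forall f : T -> R[i],
    (forall e : R, 0 < e ->
       exists2 g, bf_set g & forall t, `|f t - g t| <= e%:C) -> bf_set f
}.

Section bfun.
Context {R : realType} {T : Type}.
Implicit Type V : bfspace R T.
Local Notation normc := (@Normc.normc R).

Definition bf_pred V : {pred T -> R[i]} := fun f => f \in bf_set V.

Record bfun V := BFun {
  bfun_fun :> T -> R[i];
  bfunP : bf_pred V bfun_fun
}.

Definition mkbfun V (f : T -> R[i]) (Vf : bf_set V f) : bfun V :=
  BFun (mem_set Vf : bf_pred V f).

Lemma bf_pred_submod V : submod_closed (bf_pred V).
Proof.
split=> [|a f g]; first exact/mem_set/bf_zero.
by move=> /set_mem Vf /set_mem Vg; apply/mem_set/bf_lin.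
Qed.

HB.instance Definition _ V :=
  GRing.isSubmodClosed.Build R[i] (T -> R[i]) (bf_pred V) (bf_pred_submod V).
HB.instance Definition _ V := [isSub of bfun V for @bfun_fun V].
HB.instance Definition _ V := [Choice of bfun V by <:].
HB.instance Definition _ V := [SubChoice_isSubLmodule of bfun V by <:].

Definition sup_norm V (f : bfun V) : R := sup (range (fun t => normc (f t))).

Lemma bfunD V (f g : bfun V) t : (f + g) t = f t + g t. Proof. by []. Qed.
Lemma bfunB V (f g : bfun V) t : (f - g) t = f t - g t. Proof. by []. Qed.
Lemma bfunZ V a (f : bfun V) t : (a *: f) t = a * f t. Proof. by []. Qed.

Lemma bfun_ext V (f g : bfun V) : (forall t, f t = g t) -> f = g.
Proof. by move=> fg; apply/val_inj/funext. Qed.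

Lemma bfun_ubound V (f : bfun V) : exists M : R, forall t, normc (f t) <= M.
Proof.
have [M [/complex_realP[k ->] Mf]] := bf_bounded (set_mem (bfunP f)).
exists (k + 1) => t; rewrite -lecR -normcE.
by apply: Mf => //; rewrite ltcR ltrDl.
Qed.

Lemma le_sup_norm V (f : bfun V) t : normc (f t) <= sup_norm f.
Proof.
have [M fM] := bfun_ubound f.
by apply: sup_ubound; [exists M => _ [s _ <-]|exists t].
Qed.

Lemma sup_norm_le V (f : bfun V) (M : R) :
  0 <= M -> (forall t, normc (f t) <= M) -> sup_norm f <= M.
Proof.
move=> M0 fM; rewrite /sup_norm.
have [->|/set0P ne] := eqVneq (range (fun t => normc (f t))) set0.
  by rewrite sup0.
by apply: ge_sup => // _ [t _ <-].
Qed.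

Lemma sup_norm_ge0 V (f : bfun V) : 0 <= sup_norm f.
Proof.
rewrite /sup_norm.
have [->|/set0P[_ [t _ _]]] := eqVneq (range (fun t => normc (f t))) set0.
  by rewrite sup0.
exact: le_trans (normc_ge0 (f t)) (le_sup_norm f t).
Qed.

Lemma sup_normD V (f g : bfun V) :
  (sup_norm (f + g))%:C <= (sup_norm f)%:C + (sup_norm g)%:C.
Proof.
rewrite -rmorphD lecR; apply: sup_norm_le => [|t]; first by rewrite addr_ge0 ?sup_norm_ge0.
rewrite bfunD -lecR -normcE (le_trans (ler_normD _ _))//.
by rewrite !normcE -rmorphD lecR lerD ?le_sup_norm.
Qed.

Lemma sup_normZ V (a : R[i]) (f : bfun V) :
  (sup_norm (a *: f))%:C = `|a| * (sup_norm f)%:C.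
Proof.
rewrite normcE -rmorphM; congr (_%:C).
have le (b : R[i]) (h : bfun V) : sup_norm (b *: h) <= normc b * sup_norm h.
  apply: sup_norm_le => [|t]; first by rewrite mulr_ge0 ?normc_ge0 ?sup_norm_ge0.
  by rewrite bfunZ Normc.normcM ler_wpM2l ?normc_ge0 ?le_sup_norm.
apply/eqP; rewrite eq_le le /=.
have [->|a0] := eqVneq a 0; first by rewrite Normc.normc0 mul0r sup_norm_ge0.
rewrite -{1}[f](scalerK a0) -ler_pdivlMl ?invr_gt0 ?lt0r ?normc_ge0 ?andbT; last first.
  by apply: contra a0 => /eqP/Normc.eq0_normc ->.
by rewrite -Normc.normcV le.
Qed.

Lemma sup_norm_eq0 V (f : bfun V) : (sup_norm f)%:C = 0 -> f = 0.
Proof.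
move=> /complexI f0; apply: bfun_ext => t; apply: Normc.eq0_normc.
by apply/eqP; rewrite eq_le normc_ge0 -{1}f0 le_sup_norm.
Qed.

HB.instance Definition _ V :=
  @Lmodule_isNormed.Build R[i] (bfun V) (fun f => (sup_norm f)%:C)
    (@sup_normD V) (@sup_normZ V) (@sup_norm_eq0 V).

Lemma bfun_normE V (f : bfun V) : `|f| = (sup_norm f)%:C. Proof. by []. Qed.

Lemma bfun_complete V (F : set_system (bfun V)) : ProperFilter F -> cauchy F -> cvg F.
Proof.
move=> FF /cauchyP Fc.
have Fce (e : R) : 0 < e -> exists h : bfun V, F [set f : bfun V | forall t, normc (h t - f t) < e].
  move=> e0; have /Fc[h Fh] : 0 < e%:C by rewrite ltcR.
  exists h; apply: filterS Fh => f; rewrite -ball_normE /= bfun_normE ltcR => hf t.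
  by rewrite -bfunB; apply: le_lt_trans hf; exact: le_sup_norm.
have ev_cvg t : cvg ((fun f : bfun V => f t) @ F).
  apply/cauchy_cvgP; apply: cauchy_exP => e /gt0_complex[-> e0].
  have [h Fh] := Fce _ e0; exists (h t).
  apply: (@filterS _ F _ _ _ _ Fh) => f /= /(_ t) hf.
  by rewrite -ball_normE /ball_ /= normcE ltcR.
pose g t := lim ((fun f : bfun V => f t) @ F).
have Fg (e : R) : 0 < e -> F [set f : bfun V | forall t, normc (g t - f t) <= e].
  move=> e0; have e2 : 0 < e / 4 by rewrite divr_gt0.
  have [h Fh] := Fce _ e2.
  apply: filterS (Fh) => f hf t.
  have [f' [hf' gf']] : exists f' : bfun V, normc (h t - f' t) < e / 4 /\ normc (g t - f' t) <= e / 4.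
    have Fgt : F [set f' : bfun V | normc (g t - f' t) <= e / 4].
      by have /cvgcP := ev_cvg t; apply.
    by have [f' [hf' gf']] := @filter_ex _ F _ _ (filterI Fh Fgt); exists f'.
  rewrite (_ : g t - f t = (g t - f' t) + (- (h t - f' t) + (h t - f t))); last first.
    by rewrite opprB !subrKA.
  rewrite -lecR -normcE (le_trans (ler_normD _ _))//.
  apply: (@le_trans _ _ ((e / 4) %:C + ((e/4)%:C + (e/4)%:C))).
    rewrite lerD//; first by rewrite normcE lecR.
    rewrite (le_trans (ler_normD _ _))// normrN !normcE lerD// lecR ltW//.
  by rewrite -!rmorphD lecR; lra.
have Vg : bf_set V g.
  apply: bf_closed => e e0.
  have [f fP] := @filter_ex _ F _ _ (Fg _ e0).
  by exists f => [|t]; [exact/set_mem/bfunP|rewrite normcE lecR].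
apply/cvg_ex; exists (mkbfun Vg).
apply/(@cvgrPdist_le _ _ _ F) => e /gt0_complex[-> e0].
apply: filterS (Fg _ e0) => f fP.
by rewrite bfun_normE lecR sup_norm_le// ltW.
Qed.

HB.instance Definition _ V :=
  Uniform_isComplete.Build (bfun V) (@bfun_complete V).

End bfun.

Section Linf.
Context (R : realType) (T : Type).
Implicit Types f g : T -> R[i].

Lemma bounded_funcP f : bounded_fun f <-> exists M : R, forall t, `|f t| <= M%:C.
Proof.
split=> [[M [/complex_realP[k ->] Mf]]|[M Mf]].
  by exists (k + 1) => t; apply: Mf => //; rewrite ltcR ltrDl.
exists M%:C; split; first by apply/complex_realP; exists M.
by move=> r Mr t _; exact: le_trans (Mf t) (ltW Mr).
Qed.

Lemma bounded_fun_lin (a : R[i]) f g :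
  bounded_fun f -> bounded_fun g -> bounded_fun (a *: f + g).
Proof.
move=> /bounded_funcP[M fM] /bounded_funcP[N gN]; apply/bounded_funcP.
exists (Normc.normc a * M + N) => t.
rewrite (le_trans (ler_normD _ _))// rmorphD rmorphM/= lerD//.
by rewrite -normcE -[(a *: f) t]/(a * f t) normrM ler_wpM2l.
Qed.

Lemma bounded_fun_closed f :
  (forall e : R, 0 < e ->
     exists2 g, bounded_fun g & forall t, `|f t - g t| <= e%:C) -> bounded_fun f.
Proof.
move=> /(_ 1 ltr01)[g /bounded_funcP[M gM] fg]; apply/bounded_funcP.
exists (1 + M) => t; rewrite -[f t](subrK (g t)) (le_trans (ler_normD _ _))//.
by rewrite rmorphD lerD.
Qed.

Lemma bounded_fun_cst (c : R[i]) : bounded_fun (fun _ : T => c).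
Proof. by apply/bounded_funcP; exists (Normc.normc c) => t; rewrite normcE. Qed.

Definition bounded_space : bfspace R T :=
  BFSpace (@subset_refl _ _) (bounded_fun_cst 0) bounded_fun_lin bounded_fun_closed.


End Linf.
Notation Linf R T := (bfun (bounded_space R T)).

Section cont_space.
Context (R : realType) (X : topologicalType).
Implicit Types f g : X -> R[i].

Lemma continuous_bounded f : compact [set: X] -> continuous f -> bounded_fun f.
Proof.
move=> cX cf.
have [M MP] : exists M : R, forall z, (f @` setT) z -> Normc.normc z <= M.
  apply: compact_complexP; apply: continuous_compact => //.
  exact: continuous_subspaceT.
by apply/bounded_funcP; exists M => t; rewrite normcE lecR; apply: MP; exists t.
Qed.

Lemma continuous_lin (a : R[i]) f g :
  continuous f -> continuous g -> continuous (a *: f + g : X -> R[i]).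
Proof.
by move=> cf cg x; apply: cvgD; [apply: cvgZr; exact: cf|exact: cg].
Qed.

Lemma continuous_closed f :
  (forall e : R, 0 < e ->
     exists2 g, continuous g & forall t, `|f t - g t| <= e%:C) -> continuous f.
Proof.
move=> fe x; apply/(@cvgcP _ _ (nbhs x)) => e e0.
have e4 : 0 < e / 4 by rewrite divr_gt0.
have [g cg fg] := fe _ e4.
have /cvgcP/(_ _ e4) := cg x; apply: filterS => t gt.
have tri : `|f x - f t| <= `|f x - g x| + `|g x - g t| + `|f t - g t|.
  rewrite (_ : f x - f t = (f x - g x) + (g x - g t) - (f t - g t)); last first.
    by rewrite subrKA opprB subrKA.
  by apply: le_trans (ler_normB _ _) _; rewrite lerD2r ler_normD.
rewrite -lecR -normcE; apply: le_trans tri _.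
apply: (@le_trans _ _ ((e / 4)%:C + (e / 4)%:C + (e / 4)%:C)).
  by rewrite !lerD//= normcE lecR.
by rewrite -!rmorphD lecR; lra.
Qed.

Definition cont_space (cX : compact [set: X]) : bfspace R X :=
  BFSpace (fun f => @continuous_bounded f cX) (fun=> cvg_cst 0)
    continuous_lin continuous_closed.
End cont_space.

Section semigroup_amenability.
Context (R : realType) (S : semigroupType).
Local Notation C := R[i].

Lemma bounded_fun_ltrans (s : S) (phi : Linf R S) :
  bounded_fun (fun t : S => phi (s * t)%g).
Proof.
have /bounded_funcP[M phiM] := set_mem (bfunP phi).
by apply/bounded_funcP; exists M.
Qed.

Definition ltrans (s : S) (phi : Linf R S) : Linf R S :=
  mkbfun (V := bounded_space R S) (bounded_fun_ltrans s phi).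

Definition Linf_cst (c : C) : Linf R S :=
  mkbfun (V := bounded_space R S) (@bounded_fun_cst R S c).

Definition is_mean (M : Linf R S -> C) : Prop :=
  [/\ scalar M, continuous M,
      forall phi : Linf R S, (forall s, 0 <= phi s) -> 0 <= M phi &
      M (Linf_cst 1) = 1].

Definition left_amenable (X : set (Linf R S)) : Prop :=
  exists2 M : Linf R S -> C, is_mean M &
    forall s phi, X phi -> M (ltrans s phi) = M phi.

Definition lin_span (E : lmodType C) (A : set E) : set E :=
  [set x | exists n (c : 'I_n -> C) (v : 'I_n -> E),
     (forall i, A (v i)) /\ x = \sum_(i < n) c i *: v i].

Record topdual (B : normedModType C) := TopDual {
  dual_fun :> B -> C;
  dual_scalar : scalar dual_fun;
  dual_continuous : continuous dual_fun
}.

Record bounded_rep (B : completeNormedModType C) := BoundedRep {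
  rep :> S -> B -> B;
  rep_linear : forall s, linear (rep s);
  rep_continuous : forall s, continuous (rep s);
  rep_morph : (forall s t b, rep (s * t)%g b = rep s (rep t b)) \/
              (forall s t b, rep (s * t)%g b = rep t (rep s b));
  rep_bounded : exists M : C, forall s b, `|rep s b| <= M * `|b|
}.

Section rep_amenable.
Context (B : completeNormedModType C) (rho : bounded_rep B).

Lemma dual_bound (b' : topdual B) :
  exists2 M : C, 0 <= M & forall b, `|b' b| <= M * `|b|.
Proof.
pose f : {linear B -> C} :=
  HB.pack (dual_fun b') (GRing.isLinear.Build _ _ _ _ _ (dual_scalar b')).
have /linear_boundedP : bounded_near f (nbhs 0).
  exact/linear_bounded_continuous/dual_continuous.
move=> /pinfty_ex_gt0[M M0 fM]; exists M => //; exact: ltW.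
Qed.

Lemma bounded_fun_coef (b : B) (b' : topdual B) :
  bounded_fun (fun s : S => b' (rho s b)).
Proof.
have [M rhoM] := rep_bounded rho; have [N N0 bN] := dual_bound b'.
have K s : `|b' (rho s b)| <= N * (M * `|b|).
  by apply: le_trans (bN _) _; rewrite ler_wpM2l.
apply/bounded_funcP; exists (complex.Re (N * (M * `|b|))) => s.
by have := K s; rewrite normcE lecE /= lecR => /andP[].
Qed.

Definition rep_coef (b : B) (b' : topdual B) : Linf R S :=
  mkbfun (V := bounded_space R S) (bounded_fun_coef b b').

Definition Yrep : set (Linf R S) :=
  closure (lin_span [set phi | exists b b', phi = rep_coef b b']).

Definition Xrep : set (Linf R S) :=
  lin_span (Yrep `|` [set phi | exists c, phi = Linf_cst c]).

Definition left_amenable_rep : Prop := left_amenable Xrep.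
End rep_amenable.
End semigroup_amenability.

Notation riemann_sphere R := (one_point_compactification R[i]).


Section rational.
Variable R : realType.
Local Notation C := R[i].
Local Notation normc := (@Normc.normc R).

Definition proj_ratio (a b : C) : riemann_sphere R := if b == 0 then None else Some (a / b).

Definition ratmap (P Q : {poly C}) (z : riemann_sphere R) : riemann_sphere R :=
  match z with
  | Some w => proj_ratio P.[w] Q.[w]
  | None => let d := (maxn (size P) (size Q)).-1 in proj_ratio P`_d Q`_d
  end.

Definition rational_map (f : riemann_sphere R -> riemann_sphere R) : Prop :=
  exists P Q : {poly C}, coprimep P Q /\ f = ratmap P Q.

Lemma cvg_Some T (F : set_system T) (FF : Filter F) (f : T -> C) z :
  f @ F --> z -> (Some (f t) : riemann_sphere R) @[t --> F] --> (Some z : riemann_sphere R).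
Proof. by move=> fz; apply: cvg_comp fz _; exact: one_point_compactification_some_continuous. Qed.

Lemma cvg_None T (F : set_system T) (FF : Filter F) (f : T -> riemann_sphere R) :
  (forall M : R, F [set t | if f t is Some w then M < normc w else True]) ->
  f @ F --> (None : riemann_sphere R).
Proof.
move=> fM U [K [cK _] KU]; have [M KM] := compact_complexP cK.
apply: (@filterS _ F _ _ _ _ (fM M)) => t /= ft; apply: KU.
case: (f t) ft => [w Mw|_]; [left; exists w => // /KM|by right].
by rewrite leNgt Mw.
Qed.

Lemma cvg_proj_ratio T (F : set_system T) (FF : Filter F) (f g : T -> C) (a b : C) :
  f @ F --> a -> g @ F --> b -> (a != 0) || (b != 0) ->
  proj_ratio (f t) (g t) @[t --> F] --> proj_ratio a b.
Proof.
move=> fa gb ab; rewrite {2}/proj_ratio; case: (eqVneq b 0) ab => [b0|b0 _].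
  rewrite orbF => a0; apply: cvg_None => M.
  have na : 0 < normc a by rewrite -ltcR -normcE normr_gt0.
  pose N := Num.max M 1.
  have N0 : 0 < N by rewrite lt_max ltr01 orbT.
  have e1 : 0 < normc a / 2 by rewrite divr_gt0.
  have e2 : 0 < normc a / 4 / N by rewrite !divr_gt0.
  move/cvgcP/(_ _ e1) : fa; move/cvgcP/(_ _ e2) : gb.
  apply: filterS2 => t gbt fat; rewrite /proj_ratio /=; case: (eqVneq (g t) 0) => // gt0.
  rewrite b0 sub0r normcN in gbt.
  have ng : 0 < normc (g t).
    by rewrite -ltcR -normcE normr_gt0.
  have fat' : normc a / 2 <= normc (f t).
    have : normc a <= normc (a - f t) + normc (f t).
      by rewrite -lecR rmorphD/= -!normcE -{1}[a](subrK (f t)) ler_normD.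
    lra.
  rewrite Normc.normcM Normc.normcV ltr_pdivlMr// (lt_le_trans _ fat')//.
  apply: (@le_lt_trans _ _ (N * normc (g t))).
    by rewrite ler_pM2r// le_max lexx.
  apply: (@le_lt_trans _ _ (normc a / 4)); last by lra.
  by rewrite mulrC -ler_pdivlMr.
have gn0 : \forall t \near F, g t != 0 by apply: cvgr_neq0 b0.
have : Some (f t / g t) @[t --> F] --> (Some (a / b) : riemann_sphere R).
  apply: (@cvg_Some _ F FF (fun t => f t / g t)).
  exact: (@cvgM C _ F FF f (fun t => (g t)^-1) a b^-1 fa (cvgV b0 gb)).
apply: cvg_trans; apply: near_eq_cvg; apply: filterS gn0 => t gt0.
by rewrite /proj_ratio (negbTE gt0).
Qed.

Definition sinv (z : riemann_sphere R) : C := if z is Some w then w^-1 else 0.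

Lemma sinv_cvg : sinv z @[z --> (None : riemann_sphere R)] --> (0 : C).
Proof.
apply/(@cvgcP _ _ (nbhs (None : riemann_sphere R))) => e e0.
exists [set w : C | normc w <= e^-1].
  split; [exact: compact_normc_le|exact: closed_normc_le].
case=> [w|]; last by move=> _; rewrite /sinv subr0 Normc.normc0 ltW.
rewrite /sinv; case=> [[x /negP + [wx]]|//]; rewrite -ltNge -wx => ew.
rewrite sub0r normcN Normc.normcV.
by rewrite invf_ple ?posrE// ?(lt_trans _ ew) ?invr_gt0// ltW.
Qed.

Lemma cvg_horner T (F : set_system T) (FF : Filter F) (f : T -> C) z (P : {poly C}) :
  f @ F --> z -> P.[f t] @[t --> F] --> P.[z].
Proof.
move=> fz; elim/poly_ind: P => [|P c IH].
  by under eq_fun do rewrite horner0; rewrite horner0; exact: cvg_cst.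
under eq_fun do rewrite hornerMXaddC; rewrite hornerMXaddC.
have IHf := @cvgM C _ F FF _ f _ z IH fz.
exact: (@cvgD C C _ F FF _ (fun=> c) _ c IHf (cvg_cst _)).
Qed.

Definition revp d (P : {poly C}) : {poly C} := \poly_(i < d.+1) P`_(d - i).

Lemma revpE d (P : {poly C}) w : (size P <= d.+1)%N -> w != 0 ->
  P.[w] = w ^+ d * (revp d P).[w^-1].
Proof.
move=> sP w0; rewrite horner_poly (horner_coef_wide _ sP) big_distrr /=.
rewrite (reindex_inj rev_ord_inj) /=; apply: eq_bigr => i _.
rewrite mulrCA subSS; congr (_ * _).
by rewrite exprVn -expfB_cond ?(negbTE w0)//= -ltnS ltn_ord.
Qed.

Lemma revp0 d (P : {poly C}) : (revp d P).[0] = P`_d.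
Proof. by rewrite horner_coef0 coef_poly subn0. Qed.

Lemma ratmap_continuous (P Q : {poly C}) : coprimep P Q -> continuous (ratmap P Q).
Proof.
move=> cPQ [w|].
  have hor (p : {poly C}) : p.[t] @[t --> w] --> p.[w].
    exact: (@cvg_horner C (nbhs w) (nbhs_filter w) id w p (fun _ => id)).
  suff: (P.[w] != 0) || (Q.[w] != 0).
    exact: (@cvg_proj_ratio _ (nbhs w) _ (horner P) (horner Q) _ _ (hor P) (hor Q)).
  rewrite -negb_and; apply/negP => /andP[/eqP Pw Qw].
  by have := coprimep_root cPQ; move=> /(_ w); rewrite rootE Pw eqxx Qw => /(_ isT).
rewrite /continuous_at /=; set d := (maxn _ _).-1.
have sP : (size P <= d.+1)%N by rewrite (leq_trans (leq_maxl _ (size Q)))// leqSpred.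
have sQ : (size Q <= d.+1)%N by rewrite (leq_trans (leq_maxr (size P) _))// leqSpred.
have : proj_ratio (revp d P).[sinv z] (revp d Q).[sinv z] @[z --> (None : riemann_sphere R)]
    --> proj_ratio P`_d Q`_d.
  have hor p : (revp d p).[sinv z] @[z --> (None : riemann_sphere R)] --> p`_d.
    rewrite -revp0.
    exact: (@cvg_horner _ (nbhs (None : riemann_sphere R)) _ sinv 0 _ sinv_cvg).
  suff: (P`_d != 0) || (Q`_d != 0).
    exact: (@cvg_proj_ratio _ (nbhs (None : riemann_sphere R)) _ (fun z => (revp d P).[sinv z])
              (fun z => (revp d Q).[sinv z]) _ _ (hor P) (hor Q)).
  rewrite -negb_and; apply/negP; rewrite /d; clear sP sQ hor d.
  have [PQ|/ltnW PQ] := leqP (size P) (size Q); last first.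
    rewrite -/(lead_coef P) lead_coef_eq0 => /andP[/eqP P0 _].
    move: PQ cPQ; rewrite P0 size_poly0 leqn0 size_poly_eq0 => /eqP ->.
    by rewrite /coprimep gcd0p size_poly0.
  rewrite -/(lead_coef Q) lead_coef_eq0 => /andP[_ /eqP Q0].
  move: PQ cPQ; rewrite Q0 size_poly0 leqn0 size_poly_eq0 => /eqP ->.
  by rewrite /coprimep gcd0p size_poly0.
apply: cvg_trans; apply: near_eq_cvg; first exact: (nbhs_filter (None : riemann_sphere R)).
exists [set w : C | normc w <= 0].
  split; [exact: compact_normc_le|exact: closed_normc_le].
case=> [w|] /=; last by rewrite !revp0.
case=> [[x /negP w0 [wx]]|//]; rewrite -{}wx {w}.
have {}w0 : x != 0 by apply: contraNneq w0 => ->; rewrite Normc.normc0.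
rewrite (revpE sP w0) (revpE sQ w0).
rewrite /proj_ratio !mulf_eq0 expf_eq0 (negbTE w0) andbF /=.
by case: ifP => // _; rewrite -mulf_div divff ?mul1r// expf_neq0.
Qed.
End rational.

Record rat_semigroup (R : realType) := RatSemigroup {
  rs_set :> set (riemann_sphere R -> riemann_sphere R);
  rs_rational : rs_set `<=` @rational_map R;
  rs_comp : forall f g, rs_set f -> rs_set g -> rs_set (f \o g);
  rs_nonempty : rs_set !=set0
}.

Section koopman.
Context {R : realType}.

Record rs_elt (S : rat_semigroup R) := RsElt {
  rs_fun :> riemann_sphere R -> riemann_sphere R;
  rs_funP : rs_fun \in rs_set S
}.
HB.instance Definition _ S := [isSub of rs_elt S for @rs_fun S].
HB.instance Definition _ S := [Choice of rs_elt S by <:].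

Definition rs_mul S (f g : rs_elt S) : rs_elt S :=
  RsElt (mem_set (rs_comp (set_mem (rs_funP f)) (set_mem (rs_funP g)))).

Lemma rs_mulA S : associative (@rs_mul S).
Proof. by move=> f g h; apply/val_inj. Qed.

HB.instance Definition _ S := isSemigroup.Build (rs_elt S) (@rs_mulA S).

Definition CSphere : completeNormedModType R[i] :=
  bfun (cont_space R (@one_point_compactification_compact R[i])).

Lemma rational_continuous (f : riemann_sphere R -> riemann_sphere R) :
  rational_map f -> continuous f.
Proof. by move=> [P [Q [cPQ ->]]]; exact: ratmap_continuous. Qed.

Lemma koopman_subproof S (f : rs_elt S) (phi : CSphere) :
  continuous (phi \o f).
Proof.
move=> x; apply: continuous_comp.
  exact/rational_continuous/rs_rational/set_mem/rs_funP.
exact: (set_mem (bfunP phi)).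
Qed.

Definition koopman_op S (f : rs_elt S) (phi : CSphere) : CSphere :=
  mkbfun (V := cont_space R (@one_point_compactification_compact R[i]))
    (@koopman_subproof S f phi).

Lemma koopman_linear S (f : rs_elt S) : linear (koopman_op f).
Proof. by move=> a phi psi; apply: bfun_ext. Qed.

Lemma koopman_le S (f : rs_elt S) (phi : CSphere) :
  `|koopman_op f phi| <= 1 * `|phi|.
Proof.
rewrite mul1r !bfun_normE lecR; apply: sup_norm_le => [|t].
  exact: sup_norm_ge0.
exact: (le_sup_norm phi).
Qed.

Lemma koopman_continuous S (f : rs_elt S) : continuous (koopman_op f).
Proof.
move=> phi; apply/(@cvgrPdist_le _ _ _ (nbhs phi)) => e e0.
near=> psi.
have -> : koopman_op f phi - koopman_op f psi = koopman_op f (phi - psi).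
  exact: bfun_ext.
apply: le_trans (koopman_le _ _) _; rewrite mul1r.
near: psi; exact: (@cvgr_dist_le _ _ _ (nbhs phi) _ id phi (fun _ => id)).
Unshelve. all: by end_near. Qed.

Lemma koopman_morph S (f g : rs_elt S) (phi : CSphere) :
  koopman_op (f * g)%g phi = koopman_op g (koopman_op f phi).
Proof. exact: bfun_ext. Qed.

Definition koopman S : bounded_rep (rs_elt S) CSphere :=
  @BoundedRep R (rs_elt S) CSphere (@koopman_op S) (@koopman_linear S)
    (@koopman_continuous S) (or_intror (@koopman_morph S))
    (ex_intro _ 1 (@koopman_le S)).

End koopman.

Definition borel_sphere (R : realType) :=
  g_sigma_algebraType (@open (riemann_sphere R)).
HB.instance Definition _ R := Measurable.on (borel_sphere R).

(* Main.v *)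
From HB Require Import structures.
Require Import Defs.
From mathcomp Require Import all_boot all_order all_algebra complex.
From mathcomp Require Import all_classical all_reals all_analysis.
From mathcomp Require Import lra.
Import Order.TTheory GRing.Theory Num.Theory numFieldNormedType.Exports.
Local Open Scope classical_set_scope.
Local Open Scope ring_scope.

(** Why the theorem is true. Fix a point of the sphere, here the point at
    infinity, and a mean [M] on the bounded functions on [S] that is left
    invariant on the matrix coefficients of the Koopman representation.
    Averaging a continuous function over the orbit of that point,
    [L f = Re (M (s |-> f (s oo)))], gives a positive normalized linear functional on
    the continuous functions of the sphere. The function [s |-> f (s oo)] is the
    coefficient of [f] against the evaluation at infinity, and replacing [f] by
    [f \o g] translates it on the left by [g]; hence [L (f \o g) = L f]
    ([mean_state_invariant]).

    It remains to pass from [L] to a measure. The Daniell outer measure of a set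
    [A] is the infimum of [\sum_n L (F n)] over the sequences of nonnegative
    continuous functions whose sum is at least 1 on [A]. This choice makes
    invariance almost free: composing with [g] turns a sequence that serves [A]
    into one that serves [g @^-1` A] and costs the same, so the preimage never
    has a larger outer measure; as the total mass is 1, the same inequality for
    the complement gives equality on measurable sets
    ([daniell_measure_invariant]).

    Three facts make the outer measure a Borel probability measure. The sets
    where a nonnegative continuous function is positive are Caratheodory
    measurable ([cozero_caratheodory]); they generate the Borel sets of the
    sphere ([sphere_open_cozero]); and the total mass is 1 because the sphere is
    compact ([daniell_outer_setT]). *)

(** * Series of nonnegative extended reals *)

Section series.
Context {R : realType}.
Local Open Scope ereal_scope.

Lemma nneseries_flatten (f : {bij [set: nat] >-> [set: nat * nat]})
    (a : nat -> nat -> \bar R) : (forall n m, 0 <= a n m) ->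
  \sum_(k <oo) a (f k).1 (f k).2 = \sum_(n <oo) \sum_(m <oo) a n m.
Proof.
move=> a0; rewrite nneseries_esumT//.
rewrite -(@reindex_esum _ _ _ _ [set: nat * nat] f (fun p => a p.1 p.2)); last exact: bij.
rewrite nneseries_esumT; last by move=> n; exact: nneseries_ge0.
under [RHS]eq_esum do rewrite nneseries_esumT//.
rewrite esum_esum//; congr esum.
by apply/seteqP; split.
Qed.

(** A convergent series of nonnegative terms can be cut with an error at most [e]:
    this supplies the cut-off indices in [cozero_caratheodory]. *)
Lemma nneseries_adherent (a : nat -> \bar R) (e : R) : (forall n, 0 <= a n) ->
  \sum_(n <oo) a n < +oo -> (0 < e)%R ->
  exists N, \sum_(n <oo) a n <= \sum_(0 <= n < N) a n + e%:E.
Proof.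
move=> a0 aoo e0.
have nd : nondecreasing_seq (fun n => \sum_(0 <= i < n) a i).
  exact: ereal_nondecreasing_series.
have E : \sum_(n <oo) a n = ereal_sup (range (fun n => \sum_(0 <= i < n) a i)).
  by apply/cvg_lim => //; exact: ereal_nondecreasing_cvgn.
have fin : \sum_(n <oo) a n \is a fin_num by rewrite ge0_fin_numE// nneseries_ge0.
rewrite E in fin *.
have [_ [N _ <-] /ltW H] := ub_ereal_sup_adherent e0 fin.
by exists N; rewrite -leeBlDr.
Qed.

Lemma nneseries_partial_lt (a : nat -> R) (c : R) : (forall n, 0 <= a n)%R ->
  c%:E < \sum_(n <oo) (a n)%:E -> exists N, (c < \sum_(n < N) a n)%R.
Proof.
move=> a0.
have -> : \sum_(n <oo) (a n)%:E
    = ereal_sup (range (fun n => \sum_(0 <= i < n) (a i)%:E)).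
  apply/cvg_lim => //; apply: ereal_nondecreasing_cvgn.
  by apply: ereal_nondecreasing_series => n _ _; rewrite lee_fin.
move=> /ereal_sup_gt[_ [N _ <-]]; rewrite sumEFin lte_fin => cN.
by exists N; rewrite big_mkord in cN.
Qed.

End series.

(** * Positive normalized functionals on continuous functions *)

(** A state in the sense of functional analysis, on real continuous functions.
    The functional is total on [X -> R], which avoids carrying continuity proofs
    in its argument; its values at discontinuous functions are unconstrained. *)
Record state (R : realType) (X : topologicalType) := State {
  state_fun :> (X -> R) -> R;
  stateD : forall f g : X -> R, continuous f -> continuous g ->
    state_fun (f \+ g) = state_fun f + state_fun g;
  stateZ : forall (a : R) (f : X -> R), continuous f ->
    state_fun (fun x => a * f x) = a * state_fun f;
  state_ge0 : forall f : X -> R, continuous f -> (forall x, 0 <= f x) ->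
    0 <= state_fun f;
  state1 : state_fun (cst 1) = 1
}.
Arguments State {R X}.
Arguments stateD {R X}.
Arguments stateZ {R X}.
Arguments state_ge0 {R X}.
Arguments state1 {R X}.

Section state_theory.
Context {R : realType} {X : topologicalType} (L : state R X).
Implicit Types f g : X -> R.

Lemma continuousDf f g : continuous f -> continuous g -> continuous (f \+ g).
Proof. by move=> cf cg x; apply: cvgD; [exact: cf|exact: cg]. Qed.

Lemma continuousMf f g :
  continuous f -> continuous g -> continuous (fun x => f x * g x).
Proof. by move=> cf cg x; apply: cvgM; [exact: cf|exact: cg]. Qed.

Lemma state_cst c : L (cst c) = c.
Proof.
rewrite (_ : cst c = fun x => c * cst 1 x); last by apply/funext => x /=; rewrite mulr1.
by rewrite stateZ ?state1 ?mulr1// => x; exact: cvg_cst.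
Qed.

Lemma stateB f g : continuous f -> continuous g -> L (f \- g) = L f - L g.
Proof.
move=> cf cg.
have cNg : continuous (fun x => -1 * g x).
  by apply: continuousMf => // x; exact: cvg_cst.
rewrite (_ : f \- g = f \+ (fun x => -1 * g x)); last first.
  by apply/funext => x /=; rewrite mulN1r.
by rewrite stateD// stateZ// mulN1r.
Qed.

Lemma continuousBf f g : continuous f -> continuous g -> continuous (f \- g).
Proof. by move=> cf cg x; apply: cvgB; [exact: cf|exact: cg]. Qed.

Lemma le_state f g : continuous f -> continuous g ->
  (forall x, f x <= g x) -> L f <= L g.
Proof.
move=> cf cg fg; rewrite -subr_ge0 -stateB//.
by apply: state_ge0 => [|x]; [exact: continuousBf|rewrite subr_ge0].
Qed.

Lemma continuous_sumf (F : nat -> X -> R) N : (forall n, continuous (F n)) ->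
  continuous (fun x => \sum_(i < N) F i x).
Proof.
move=> cF; elim: N => [|N IH].
  rewrite (_ : (fun _ => _) = cst 0); first by move=> x; exact: cvg_cst.
  by apply/funext => x; rewrite big_ord0.
rewrite (_ : (fun _ => _) = (fun x => \sum_(i < N) F i x) \+ F N).
  exact: continuousDf.
by apply/funext => x; rewrite big_ord_recr.
Qed.

Lemma state_sum (F : nat -> X -> R) N : (forall n, continuous (F n)) ->
  L (fun x => \sum_(i < N) F i x) = \sum_(i < N) L (F i).
Proof.
move=> cF; elim: N => [|N IH].
  rewrite big_ord0 (_ : (fun _ => _) = cst 0) ?state_cst//.
  by apply/funext => x; rewrite big_ord0.
rewrite big_ord_recr/= -IH -stateD//; last exact: continuous_sumf.
by congr (L _); apply/funext => x; rewrite big_ord_recr.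
Qed.

End state_theory.

(** * The Daniell outer measure of a state *)

Section daniell.
Context {R : realType} {X : topologicalType} (L : state R X).
Local Open Scope ereal_scope.

Definition cont_cover (A : set X) : set (nat -> X -> R) :=
  [set F : nat -> X -> R |
    [/\ forall n, continuous (F n), forall n x, (0 <= F n x)%R &
        forall x, A x -> 1 <= \sum_(n <oo) (F n x)%:E]].

Definition daniell_outer (A : set X) : \bar R :=
  ereal_inf [set \sum_(n <oo) (L (F n))%:E | F in cont_cover A].

Lemma daniell_outer_ge0 A : 0 <= daniell_outer A.
Proof.
apply: le_ereal_inf_tmp => _ [F [cF F0 _] <-].
by apply: nneseries_ge0 => n _ _; rewrite lee_fin state_ge0.
Qed.

Lemma le_daniell_outer : {homo daniell_outer : A B / A `<=` B >-> A <= B}.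
Proof.
move=> A B AB; apply: ereal_inf_le_tmp => _ [F [cF F0 FB] <-].
by exists F => //; split => // x /AB; exact: FB.
Qed.

Lemma daniell_outer0 : daniell_outer set0 = 0.
Proof.
apply/eqP; rewrite eq_le daniell_outer_ge0 andbT; apply: ereal_inf_lbound.
exists (fun _ _ => 0%R); first by split => // n x; exact: cvg_cst.
by apply: eseries0 => n _ _; rewrite state_cst.
Qed.

(** Covers may be indexed by [nat * nat]. Countable subadditivity needs this to
    merge one cover for each set, and [cozero_caratheodory] to cut every term of
    a cover into countably many pieces. *)
Lemma daniell_outer_le_double A (G : nat -> nat -> X -> R) :
  (forall n m, continuous (G n m)) -> (forall n m x, (0 <= G n m x)%R) ->
  (forall x, A x -> 1 <= \sum_(n <oo) \sum_(m <oo) (G n m x)%:E) ->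
  daniell_outer A <= \sum_(n <oo) \sum_(m <oo) (L (G n m))%:E.
Proof.
move=> cG G0 GA; have /card_esym/ppcard_eqP[f] := card_nat2.
apply: ereal_inf_lbound; exists (fun k => G (f k).1 (f k).2).
  split => // x /GA; rewrite -(nneseries_flatten f)// => n m.
  by rewrite lee_fin.
by rewrite -(nneseries_flatten f)// => n m; rewrite lee_fin state_ge0.
Qed.

Lemma daniell_outer_adherent A (e : R) : (0 < e)%R -> daniell_outer A < +oo ->
  exists2 F, cont_cover A F & \sum_(n <oo) (L (F n))%:E <= daniell_outer A + e%:E.
Proof.
move=> e0 Aoo; have fin : daniell_outer A \is a fin_num.
  by rewrite ge0_fin_numE// daniell_outer_ge0.
have [_ [F AF <-] /ltW H] := lb_ereal_inf_adherent e0 fin.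
by exists F.
Qed.

Lemma daniell_outer_sigma_subadditive : sigma_subadditive daniell_outer.
Proof.
move=> A; have [[i ioo]|Aoo] := pselect (exists i, daniell_outer (A i) = +oo).
  rewrite (eseries_pinfty _ _ ioo) ?leey// => n _.
  by rewrite -ltNye (lt_le_trans _ (daniell_outer_ge0 _)).
apply/lee_addgt0Pr => e e0.
apply: (le_trans _ (epsilon_trick _ _ (ltW e0))); last first.
  by move=> n; exact: daniell_outer_ge0.
have /choice[G PG] n : exists F, cont_cover (A n) F /\
    \sum_(k <oo) (L (F k))%:E <= daniell_outer (A n) + (e / (2 ^ n.+1)%:R)%:E.
  have [||F ? ?] := @daniell_outer_adherent (A n) (e / (2 ^ n.+1)%:R)%R.
  - by rewrite divr_gt0// ltr0n expn_gt0.
  - by rewrite ltey; apply/eqP => An; apply: Aoo; exists n.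
  - by exists F.
apply: (@le_trans _ _ (\sum_(n <oo) \sum_(m <oo) (L (G n m))%:E)).
  apply: daniell_outer_le_double => [n m|n m x|x [n _ Anx]].
  - by have [[]] := PG n.
  - by have [[]] := PG n.
  - have [[_ _ /(_ x Anx) H] _] := PG n; apply: (le_trans H).
    have s0 k : 0 <= \sum_(m <oo) (G k m x)%:E.
      by apply: nneseries_ge0 => m _ _; have [[_ G0 _] _] := PG k; rewrite lee_fin.
    apply: le_trans (nneseries_lim_ge n.+1 _); last by [].
    by rewrite big_nat_recr//= leeDr// sume_ge0.
apply: lee_nneseries => n; last by have [] := PG n.
move=> _ _; apply: nneseries_ge0 => m _ _; have [[cG G0 _] _] := PG n.
by rewrite lee_fin state_ge0.
Qed.

HB.instance Definition _ := isOuterMeasure.Build R X daniell_outer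
  daniell_outer0 daniell_outer_ge0 le_daniell_outer daniell_outer_sigma_subadditive.

(** The upper bound comes from the cover by the constant 1. For the lower bound,
    compactness gives Dini's argument: if the series [\sum_n F n] is at least 1
    everywhere, then one partial sum exceeds [1 - e] everywhere, so its cost
    exceeds [1 - e] too. *)
Lemma daniell_outer_setT : compact [set: X] -> daniell_outer setT = 1.
Proof.
move=> cX; apply/eqP; rewrite eq_le; apply/andP; split.
  apply: ereal_inf_lbound; exists (fun n => if n is 0%N then cst 1 else cst 0)%R.
    split.
    - by case=> [|n] x; exact: cvg_cst.
    - by case=> [|n] x /=; rewrite ?ler01.
    - move=> x _; apply: le_trans (nneseries_lim_ge 1 _).
        by rewrite big_nat1.
      by case=> [|n] _ _; rewrite lee_fin/= ?ler01.
  rewrite nneseries_recl//; last by case=> [|n] _; rewrite state_cst lee_fin ?ler01.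
  by rewrite state_cst eseries0 ?adde0// => -[//|n] _ _; rewrite state_cst.
apply: le_ereal_inf_tmp => _ [F [cF F0 FX] <-].
apply/lee_addgt0Pr => e e0.
have [N NF] : exists N, forall x, (1 - e < \sum_(i < N) F i x)%R.
  have : \forall N \near \oo, [set: X] `<=` (fun x => 1 - e < \sum_(i < N) F i x)%R.
    move/compact_near_coveringP : cX => /(_ _ \oo
      (fun N x => 1 - e < \sum_(i < N) F i x)%R eventually_filter); apply => x _.
    (* A bound for [N] terms near [x] persists for more terms, [F] being
       nonnegative; so the covering condition holds in [N] and the point jointly. *)
    have [N Nx] : exists N, (1 - e < \sum_(i < N) F i x)%R.
      apply: (@nneseries_partial_lt R (F ^~ x)) => [//|]; apply: lt_le_trans (FX x I).
      by rewrite lte_fin gtrBl.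
    exists ([set y | 1 - e < \sum_(i < N) F i y]%R, [set M | (N <= M)%N]).
      split; last by exists N.
      have := @continuous_sumf R X F N cF x.
      by move=> /cvgr_gt; apply.
    case=> y M [/= Ny NM]; apply: (lt_le_trans Ny).
    by rewrite -!(big_mkord xpredT (F ^~ y)) (@big_cat_nat _ _ _ N 0%N M)//= lerDl sumr_ge0.
  by case=> N _ /(_ N (leqnn N)) H; exists N => x; exact: H.
apply: (@le_trans _ _ ((\sum_(i < N) L (F i))%:E + e%:E)).
  rewrite -EFinD lee_fin -lerBlDr -state_sum//.
  rewrite -[leLHS](state_cst L).
  by apply: le_state => [x||x]; [exact: cvg_cst|exact: continuous_sumf|exact/ltW].
rewrite leeD2r// -sumEFin -(big_mkord xpredT (fun i => (L (F i))%:E)).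
by apply: nneseries_lim_ge => n _ _; rewrite lee_fin state_ge0.
Qed.

Lemma daniell_outer_preimage (g : X -> X) A : continuous g ->
  (forall f, continuous f -> L (f \o g) = L f) ->
  daniell_outer (g @^-1` A) <= daniell_outer A.
Proof.
move=> cg Lg; apply: le_ereal_inf_tmp => _ [F [cF F0 FA] <-].
apply: ereal_inf_lbound; exists (fun n => F n \o g).
  split => [n x|n x|x /FA//]; last exact: F0.
  by apply: continuous_comp; [exact: cg|exact: cF].
by apply: eq_eseriesr => n _; rewrite Lg.
Qed.

(** Let [u k] be the truncation of [k * h] at 1. It vanishes off [E = {h > 0}] and
    increases to 1 on [E]. A cover [F] of [A] splits into a cover of [A `&` E], by
    the functions [F n * (u k.+1 - u k)], and a cover of [A `\` E], by the
    functions [F n * (1 - u (K n))], where the [K n] are arbitrary. The first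
    costs [\sum_n s n], where [s n] is the limit of [L (F n * u k)] in [k]; taking
    [K n] so large that [L (F n * u (K n))] is within [e / 2 ^ n.+1] of [s n], the
    two covers together cost at most [e] more than [F]. *)
Lemma cozero_caratheodory (h : X -> R) : continuous h -> (forall x, 0 <= h x)%R ->
  daniell_outer.-caratheodory [set x | 0 < h x]%R.
Proof.
move=> ch h0; apply: le_caratheodory_measurable => A.
apply: le_ereal_inf_tmp => _ [F [cF F0 FA] <-].
apply/lee_addgt0Pr => e e0.
pose u k x := Num.min 1%R (k%:R * h x)%R.
pose v k x := (u k.+1 x - u k x)%R.
have cu k : continuous (u k).
  move=> x; apply: (@continuous_min _ _ (cst 1%R) (fun x => k%:R * h x)%R).
    exact: cvg_cst.
  by apply: cvgM; [exact: cvg_cst|exact: ch].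
have u01 k x : (0 <= u k x <= 1)%R.
  by rewrite /u le_min ler01 mulr_ge0// ge_min lexx.
have v0 k x : (0 <= v k x)%R.
  by rewrite subr_ge0 /u le_min !ge_min lexx/= ler_wpM2r ?orbT// ler_nat.
have cv k : continuous (v k) by exact: continuousBf.
have vE x N : (\sum_(0 <= k < N) v k x = u N x)%R.
  by rewrite telescope_sumr// (_ : u 0%N x = 0%R) ?subr0// /u mul0r min_r.
have cFv n k : continuous (fun x => F n x * v k x)%R by exact: continuousMf.
have Fv0 n k x : (0 <= F n x * v k x)%R by rewrite mulr_ge0.
have LFv0 n k : 0 <= (L (fun x => F n x * v k x)%R)%:E.
  by rewrite lee_fin state_ge0.
have LFvE n N : \sum_(0 <= k < N) (L (fun x => F n x * v k x)%R)%:E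
    = (L (fun x => F n x * u N x)%R)%:E.
  rewrite sumEFin big_mkord -(@state_sum _ _ L (fun k x => F n x * v k x)%R)//.
  congr (L _)%:E; apply/funext => x.
  by rewrite -big_distrr/= -(big_mkord xpredT (v ^~ x)) vE.
pose s n := \sum_(k <oo) (L (fun x => F n x * v k x)%R)%:E.
have cFu n N : continuous (fun x => F n x * u N x)%R by exact: continuousMf.
have s_le n : s n <= (L (F n))%:E.
  apply: lime_le; first exact: is_cvg_nneseries.
  apply: nearW => N; rewrite LFvE lee_fin; apply: le_state => // x.
  by rewrite ler_piMr//; have /andP[] := u01 N x.
have /choice[K KP] n : exists N,
    s n <= (L (fun x => F n x * u N x)%R)%:E + (e / (2 ^ n.+1)%:R)%:E.
  have [//|||N] := @nneseries_adherent R
    (fun k => (L (fun x => F n x * v k x)%R)%:E) (e / (2 ^ n.+1)%:R)%R.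
  - by apply: le_lt_trans (s_le n) _; rewrite ltry.
  - by rewrite divr_gt0// ltr0n expn_gt0.
  - by rewrite LFvE => sN; exists N.
have cw n : continuous (fun x => F n x * (1 - u (K n) x))%R.
  apply: continuousMf => // x.
  by apply: cvgB; [exact: cvg_cst|exact: cu].
have w0 n x : (0 <= F n x * (1 - u (K n) x))%R.
  by rewrite mulr_ge0// subr_ge0; have /andP[] := u01 (K n) x.
(* On [E] the differences [v k x] sum to 1, since [u N x = 1] for large [N]. *)
have inside : daniell_outer (A `&` [set x | 0 < h x]%R) <= \sum_(n <oo) s n.
  apply: daniell_outer_le_double => // x [Ax /= hx].
  apply: le_trans (FA x Ax) _; apply: lee_nneseries => n; first by rewrite lee_fin.
  move=> _; have [N Nh] : exists N, (1 <= N%:R * h x)%R.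
    exists (Num.truncn (h x)^-1).+1.
    rewrite -ler_pdivrMr// mul1r.
    by apply/ltW/truncnS_gt.
  apply: le_trans (nneseries_lim_ge N _); last by move=> k _ _; rewrite lee_fin.
  by rewrite sumEFin -big_distrr/= vE /u min_l// mulr1.
have outside : daniell_outer (A `&` ~` [set x | 0 < h x]%R)
    <= \sum_(n <oo) (L (fun x => F n x * (1 - u (K n) x))%R)%:E.
  apply: ereal_inf_lbound; exists (fun n x => F n x * (1 - u (K n) x))%R => //.
  split=> // x [Ax /= /negP]; rewrite -leNgt => hx.
  have {}hx : h x = 0%R by apply/eqP; rewrite eq_le hx h0.
  under eq_eseriesr do rewrite /u hx mulr0 min_r// subr0 mulr1.
  exact: FA.
apply: le_trans (leeD inside outside) _.
rewrite -nneseriesD; last 2 first.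
- by move=> n _ _; apply: nneseries_ge0.
- by move=> n _ _; rewrite lee_fin state_ge0.
apply: le_trans (epsilon_trick _ _ (ltW e0)); last first.
  by move=> n; rewrite lee_fin state_ge0.
apply: lee_nneseries => n _; first move=> _.
  by rewrite adde_ge0 ?nneseries_ge0// lee_fin state_ge0.
have := KP n.
have -> : (fun x => F n x * (1 - u (K n) x))%R
    = (F n \- (fun x => F n x * u (K n) x)%R)%R.
  by apply/funext => x /=; rewrite mulrBr mulr1.
rewrite stateB// EFinB.
have /fineK <- : s n \is a fin_num.
  by rewrite ge0_fin_numE ?nneseries_ge0// (le_lt_trans (s_le n))// ltry.
rewrite -!EFinD !lee_fin => H.
by rewrite addrCA lerD2l lerBlDl.
Qed.

End daniell.

(** * The measure of a state on a compact space *)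

Definition cozero_sets (R : realType) (X : topologicalType) : set (set X) :=
  [set [set x | 0 < h x] | h in
     [set h : X -> R | continuous h /\ forall x, 0 <= h x]].

Section daniell_probability.
Context {R : realType} {X : ptopologicalType} (L : state R X).
Context (cX : compact [set: X]) (openX : @open X `<=` <<s cozero_sets R X>>).
Local Notation borel := (g_sigma_algebraType (@open X)).

Lemma borel_caratheodory (A : set borel) :
  measurable A -> (daniell_outer L).-caratheodory A.
Proof.
move: A; apply: smallest_sub.
  exact: (@sigma_algebra_measurable _ (caratheodory_type (daniell_outer L))).
move=> U /openX; move: U; apply: smallest_sub.
  exact: (@sigma_algebra_measurable _ (caratheodory_type (daniell_outer L))).
by move=> _ [h [ch h0] <-]; exact: cozero_caratheodory.
Qed.

(** The two proofs are arguments so that the instances of measure and of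
    probability below, which rest on them, can be inferred from the term. *)
Definition daniell_measure of compact [set: X] & @open X `<=` <<s cozero_sets R X>>
  : set borel -> \bar R := daniell_outer L.
Local Notation mu := (daniell_measure cX openX).

Lemma daniell_measure_sigma_additive : semi_sigma_additive mu.
Proof.
move=> F mF tF mUF.
by apply: (@caratheodory_measure_sigma_additive _ _ (daniell_outer L)) => // [n|];
  exact: borel_caratheodory.
Qed.

HB.instance Definition _ := isMeasure.Build _ borel R mu
  (daniell_outer0 L) (daniell_outer_ge0 L) daniell_measure_sigma_additive.

HB.instance Definition _ := Measure_isProbability.Build _ borel R mu
  (daniell_outer_setT L cX).

Lemma daniell_measure_invariant (g : X -> X) (A : set borel) : continuous g ->
  (forall f, continuous f -> L (f \o g) = L f) -> measurable A ->
  mu (g @^-1` A) = mu A.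
Proof.
move=> cg Lg mA.
have le B : (mu (g @^-1` B) <= mu B)%E by exact: daniell_outer_preimage.
apply/eqP; rewrite eq_le le/=.
have mgA : measurable (g @^-1` A : set borel).
  have mg : measurable_fun setT (g : borel -> borel).
    apply: (@measurability _ _ borel borel setT g (@open X)) => // _ [U oU <-].
    apply: sub_sigma_algebra; rewrite setTI.
    by apply: open_comp => // x _; exact: cg.
  by rewrite -[X in measurable X]setTI; exact: mg.
(* The inequality for the complement of [A], with [mu setT = 1]. *)
have : (1 - mu (g @^-1` A) <= 1 - mu A)%E.
  by rewrite -!probability_setC//; exact: (le (~` A)).
rewrite -(fineK (fin_num_measure mu _ mgA)) -(fineK (fin_num_measure mu _ mA)).
by rewrite -!EFinB !lee_fin lerD2l lerN2.
Qed.

End daniell_probability.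

(** * Open sets of the sphere *)

Section sphere_borel.
Context {R : realType}.
Local Notation C := R[i].
Local Notation normc := (@Normc.normc R).
Local Notation sphere := (riemann_sphere R).

Definition extend0 (f : C -> R) (z : sphere) : R := if z is Some w then f w else 0.

Lemma normcB (z w : C) : normc (z - w) = normc (w - z).
Proof. by rewrite -normcN opprB. Qed.

Lemma normc_triangle (z t w : C) : normc (z - w) <= normc (z - t) + normc (t - w).
Proof. by rewrite -lecR rmorphD/= -!Defs.normcE -(subrKA t) ler_normD. Qed.

Lemma normc1_gt0 (z : C) : 0 < 1 + normc z.
Proof. by rewrite ltr_pwDl// normc_ge0. Qed.

Lemma extend0_continuous (f : C -> R) : continuous f ->
  (forall z, `|f z| <= (1 + normc z)^-1) -> continuous (extend0 f).
Proof.
move=> cf f_le [w|]; first exact: (cf w).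
apply/(@cvgrPdist_le _ _ _ (nbhs (None : sphere))) => e e0.
exists [set w : C | normc w <= e^-1].
  split; [exact: compact_normc_le|exact: closed_normc_le].
case=> [w|]; last by move=> _; rewrite /= subrr normr0 ltW.
rewrite /= sub0r normrN; case=> [[x /negP + [wx]]|//]; rewrite -ltNge -wx => ew.
apply: le_trans (f_le x) _; rewrite invf_ple ?posrE ?normc1_gt0//.
by rewrite ltW// (lt_le_trans ew)// lerDr.
Qed.

(** The distance to the complement of [V], truncated at 1; including 1 in the set
    also gives a sensible value when [V] is the whole plane. *)
Definition cut_dist (V : set C) (z : C) : R :=
  inf ([set 1] `|` [set normc (z - w) | w in ~` V]).

Lemma cut_dist_le (V : set C) z r :
  ([set 1] `|` [set normc (z - w) | w in ~` V]) r -> cut_dist V z <= r.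
Proof.
move=> Vr; apply: ge_inf => //; exists 0 => _ [->//|[w _ <-]]; exact: normc_ge0.
Qed.

Lemma cut_dist_ge (V : set C) z r : r <= 1 ->
  (forall w, ~ V w -> r <= normc (z - w)) -> r <= cut_dist V z.
Proof.
move=> r1 rV; apply: lb_le_inf; first by exists 1; left.
by move=> _ [->//|[w Vw <-]]; exact: rV.
Qed.

Lemma cut_dist_ge0 V z : 0 <= cut_dist V z.
Proof. by apply: cut_dist_ge => // w _; exact: normc_ge0. Qed.

Lemma cut_dist_lipschitz V z t : cut_dist V z <= cut_dist V t + normc (z - t).
Proof.
rewrite -lerBlDr; apply: cut_dist_ge => [|w Vw].
  rewrite lerBlDr (le_trans (cut_dist_le V z 1 _)) ?lerDl ?normc_ge0//.
  by left.
rewrite lerBlDl; apply: le_trans (normc_triangle z t w).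
by apply: cut_dist_le; right; exists w.
Qed.

Lemma cut_dist_continuous V : continuous (cut_dist V).
Proof.
move=> z; apply/(@cvgrPdist_le _ _ _ (nbhs z)) => e e0.
apply: (@filterS _ (nbhs z) _ _ _ _ (near_normc z e0)) => t zt.
rewrite ler_norml; have := cut_dist_lipschitz V z t.
have := cut_dist_lipschitz V t z; rewrite (normcB t z); lra.
Qed.

Lemma cut_dist_gt0 V z : open V -> 0 < cut_dist V z <-> V z.
Proof.
move=> oV; split=> [|Vz].
  apply: contraPP => Vz; apply/negP; rewrite -leNgt.
  by apply: cut_dist_le; right; exists z => //; rewrite subrr Normc.normc0.
have [e /gt0_complex[eE e0] eV] : exists2 e : C, 0 < e & ball z e `<=` V.
  by have /nbhs_ballP[e e0 eV] := open_nbhs_nbhs (conj oV Vz); exists e.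
apply: (@lt_le_trans _ _ (Num.min 1 (complex.Re e))); first by rewrite lt_min ltr01.
apply: cut_dist_ge => [|w Vw]; first by rewrite ge_min lexx.
rewrite ge_min; apply/orP; right; rewrite leNgt; apply/negP => zw.
by apply: Vw; apply: eV; rewrite -ball_normE/= eE Defs.normcE ltcR.
Qed.

(** The damping factor makes the function vanish at infinity, so that its
    extension by 0 is continuous on the sphere; it leaves the cozero set alone. *)
Lemma damped_cut_dist_continuous V :
  continuous (extend0 (fun z => cut_dist V z / (1 + normc z))).
Proof.
apply: extend0_continuous => z.
  apply: (@cvgM _ _ (nbhs z) _ (cut_dist V)); first exact: cut_dist_continuous.
  apply: (@cvgV _ _ (nbhs z)); first by rewrite gt_eqF// normc1_gt0.
  by apply: (@cvgD _ _ _ (nbhs z)); [exact: cvg_cst|exact: continuous_normc].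
rewrite ger0_norm ?divr_ge0 ?cut_dist_ge0 ?(ltW (normc1_gt0 z))//.
rewrite ler_piMl ?invr_ge0 ?(ltW (normc1_gt0 z))//.
by apply: cut_dist_le; left.
Qed.

(** An open subset of the plane is a cozero set of the sphere. In particular so is
    the whole plane, hence the singleton of infinity is in the sigma-algebra, and
    an arbitrary open set is its finite part with or without that singleton. *)
Lemma sphere_open_cozero : @open sphere `<=` <<s cozero_sets R sphere>>.
Proof.
move=> U oU; set G := cozero_sets R sphere.
have some_open (V : set C) : open V -> <<s G >> (Some @` V : set sphere).
  move=> oV; apply: sub_sigma_algebra.
  exists (extend0 (fun z => cut_dist V z / (1 + normc z))).
    split; first exact: damped_cut_dist_continuous.
    case=> [z|//] /=; rewrite divr_ge0 ?cut_dist_ge0//.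
    exact: ltW (normc1_gt0 z).
  apply/seteqP; split=> [[z|]/=|_ [z Vz <-]/=].
  - rewrite pmulr_lgt0 ?invr_gt0 ?normc1_gt0// => /(cut_dist_gt0 _ _ oV) Vz.
    by exists z.
  - by rewrite ltxx.
  - by rewrite divr_gt0 ?normc1_gt0//; exact/cut_dist_gt0.
have sU : <<s G >> (Some @` (Some @^-1` U) : set sphere).
  apply: some_open.
  exact: (iffLR (continuousP _) (@one_point_compactification_some_continuous C)).
have [UN|UN] := pselect (U None).
  suff -> : U = (Some @` (Some @^-1` U)) `|` ~` (Some @` [set: C]).
    apply: (@measurableU _ (g_sigma_algebraType G)) => //.
    by apply: (@measurableC _ (g_sigma_algebraType G)); apply: some_open; exact: openT.
  apply/seteqP; split=> [[z|] Uz|[z|]].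
  - by left; exists z.
  - by right=> -[].
  - by case=> [[w Uw [<-]]//|[]]; exists z.
  - by [].
suff -> : U = Some @` (Some @^-1` U) by [].
apply/seteqP; split=> [[z|] Uz//|_ [z Uz <-]//].
Qed.

End sphere_borel.

(** * The state of an invariant mean *)

Section koopman_state.
Context {R : realType} (S : rat_semigroup R).
Local Notation C := R[i].
Local Notation sphere := (riemann_sphere R).

Lemma eval_infty_scalar : scalar (fun phi : @CSphere R => phi None).
Proof. by []. Qed.

Lemma eval_infty_continuous : continuous (fun phi : @CSphere R => phi None : C).
Proof.
move=> phi; apply/(@cvgrPdist_le _ _ _ (nbhs phi)) => e e0.
near=> psi; apply: (@le_trans _ _ `|phi - psi|).
  by rewrite bfun_normE Defs.normcE lecR -bfunB; exact: le_sup_norm.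
near: psi; exact: (@cvgr_dist_le _ _ _ (nbhs phi) _ id phi (fun _ => id)).
Unshelve. all: by end_near. Qed.

Definition eval_infty : topdual (@CSphere R) :=
  TopDual eval_infty_scalar eval_infty_continuous.

Lemma realC_continuous (f : sphere -> R) :
  continuous f -> continuous (fun x => (f x)%:C%C : C).
Proof.
move=> cf x.
exact: (@cvg_complex R _ (nbhs x) _ f (fun=> 0) (f x) 0 (cf x) (cvg_cst _)).
Qed.

Definition realC {f : sphere -> R} (cf : continuous f) : @CSphere R :=
  mkbfun (V := cont_space R (@one_point_compactification_compact R[i]))
    (realC_continuous f cf).

Definition orbit_coef {f : sphere -> R} (cf : continuous f) : Linf R (rs_elt S) :=
  rep_coef (koopman S) (realC cf) eval_infty.

Lemma orbit_coefE f (cf : continuous f) (s : rs_elt S) :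
  orbit_coef cf s = (f (s None))%:C%C.
Proof. by []. Qed.

Lemma orbit_coef_Xrep f (cf : continuous f) : Xrep (koopman S) (orbit_coef cf).
Proof.
have span1 (A : set (Linf R (rs_elt S))) phi : A phi -> lin_span A phi.
  move=> Aphi; exists 1%N, (fun=> 1), (fun=> phi).
  by split=> //; rewrite big_ord1 scale1r.
apply: (span1); left; apply: subset_closure; apply: span1.
by exists (realC cf), eval_infty.
Qed.

Context (M : Linf R (rs_elt S) -> C) (meanM : is_mean M).

Definition mean_fun (f : sphere -> R) : R :=
  if pselect (continuous f) is left cf then complex.Re (M (orbit_coef cf)) else 0.

Lemma mean_funE {f} (cf : continuous f) : mean_fun f = complex.Re (M (orbit_coef cf)).
Proof.
by rewrite /mean_fun; case: pselect => // cf'; rewrite (Prop_irrelevance cf' cf).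
Qed.

Lemma mean_funD (f g : sphere -> R) : continuous f -> continuous g ->
  mean_fun (f \+ g) = mean_fun f + mean_fun g.
Proof.
move=> cf cg; rewrite (mean_funE cf) (mean_funE cg) (mean_funE (continuousDf f g cf cg)).
have -> : orbit_coef (continuousDf f g cf cg) = 1 *: orbit_coef cf + orbit_coef cg.
  by apply: bfun_ext => s; rewrite bfunD bfunZ !orbit_coefE mul1r -rmorphD.
by have [-> _ _ _] := meanM; rewrite mul1r raddfD.
Qed.

Lemma mean_funZ (a : R) (f : sphere -> R) : continuous f ->
  mean_fun (fun x => a * f x) = a * mean_fun f.
Proof.
move=> cf; have caf : continuous (fun x => a * f x).
  by apply: (@continuousMf _ _ (cst a) f) => //; exact: cst_continuous.
rewrite (mean_funE cf) (mean_funE caf).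
have M0 : M 0 = 0.
  have [MD _ _ _] := meanM; have := MD 1 0 0.
  by rewrite scale1r addr0 mul1r => /eqP; rewrite -subr_eq subrr => /eqP <-.
have -> : orbit_coef caf = a%:C%C *: orbit_coef cf + 0.
  by apply: bfun_ext => s; rewrite addr0 bfunZ !orbit_coefE -rmorphM.
have [-> _ _ _] := meanM; rewrite M0 addr0.
by case: (M _) => x y /=; rewrite mul0r subr0.
Qed.

Lemma mean_fun_ge0 (f : sphere -> R) : continuous f ->
  (forall x, 0 <= f x) -> 0 <= mean_fun f.
Proof.
move=> cf f0; rewrite (mean_funE cf); have [_ _ Mpos _] := meanM.
have /Mpos : forall s, 0 <= orbit_coef cf s by move=> s; rewrite orbit_coefE ler0c.
by rewrite lecE => /andP[].
Qed.

Lemma mean_fun1 : mean_fun (cst 1) = 1.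
Proof.
have c1 : continuous (cst 1 : sphere -> R) by exact: cst_continuous.
rewrite (mean_funE c1); have [_ _ _ M1] := meanM.
by rewrite (_ : orbit_coef c1 = Linf_cst _ 1) ?M1//; exact: bfun_ext.
Qed.

Definition mean_state : state R sphere :=
  State mean_fun mean_funD mean_funZ mean_fun_ge0 mean_fun1.

(** Since [(g * t) oo = g (t oo)], the coefficient of [f \o g] is the left
    translate by [g] of the coefficient of [f]. *)
Lemma mean_state_invariant (g : rs_elt S) (f : sphere -> R) :
  (forall s phi, Xrep (koopman S) phi -> M (ltrans s phi) = M phi) ->
  continuous f -> mean_state (f \o g) = mean_state f.
Proof.
move=> inv cf; have cg : continuous g.
  exact/rational_continuous/rs_rational/set_mem/rs_funP.
have cfg : continuous (f \o g).
  by move=> x; apply: continuous_comp; [exact: cg|exact: cf].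
rewrite /= (mean_funE cf) (mean_funE cfg) -(inv g (orbit_coef cf)).
  by congr (complex.Re (M _)); exact: bfun_ext.
exact: orbit_coef_Xrep.
Qed.

End koopman_state.

Theorem theorem13 (R : realType) (S : rat_semigroup R)
    (hS : left_amenable_rep (koopman S)) :
  exists mu : probability (borel_sphere R) R,
    forall g : riemann_sphere R -> riemann_sphere R, rs_set S g ->
    forall A : set (borel_sphere R), measurable A ->
      pushforward mu (g : borel_sphere R -> borel_sphere R) A = mu A.
Proof.
have [M meanM inv] := hS.
have cX := @one_point_compactification_compact R[i].
exists (daniell_measure (mean_state S M meanM) cX (sphere_open_cozero)).
move=> g Sg A mA; apply: daniell_measure_invariant => // [|f cf].
  exact: (rational_continuous (rs_rational Sg)).
exact: (mean_state_invariant S M meanM (RsElt (mem_set Sg)) f inv cf).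
Qed.
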